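(* Let $D$ be a domain with quotient field $K$, let $p\in D[X]$ be a monic polynomial of degree $n$ ($n$ a positive integer), and let $f(X)=g(X)/d\in K[X]$ with $g\in D[X]$, $d\in D\setminus\{0\}$. Then the following are equivalent: 1) $f\in\mathrm{Int}(M_n^p(D),M_n(D))$. 2) $g(X)$ is divisible by $p(X)$ modulo $dD[X]$. 3) The remainder of the division of $f(X)$ by $p(X)$ in $K[X]$ is in $D[X]$, that is, $f(X)=r(X)+p(X)q(X)$ for some $q\in K[X]$ and $r\in D[X]$ with $\deg(r)<n$. 4) $f\in\mathrm{Int}(\{C_p\},M_n(D))$, where $C_p$ is the companion matrix of $p(X)$.
   Context: $M_n(D)$ is the ring of $n\times n$ matrices with entries in $D$. For a subset $S\subseteq M_n(D)$, $\mathrm{Int}(S,M_n(D))=\{f\in K[X] : f(M)\in M_n(D)\text{ for all }M\in S\}$. For a monic polynomial $p\in D[X]$ of degree $n$, $M_n^p(D)$ is the set of matrices in $M_n(D)$ whose characteristic polynomial equals $p$. ''$g$ is divisible by $p$ modulo $dD[X]$'' means $g\in p(X)D[X]+dD[X]$, i.e. the reduction of $g$ in $(D/dD)[X]$ is a multiple of the reduction of $p$. *)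

(* Defs.v *)
From mathcomp Require Import all_boot all_order all_algebra.

Set Implicit Arguments.
Unset Strict Implicit.
Unset Printing Implicit Defensive.

Import GRing.Theory.

Local Open Scope ring_scope.

(* The matrices have positive size n.+1, as needed by [horner_mx]; a monic
   polynomial of degree n.+1 then has [size] n.+2. *)

(* f belongs to Int(S, M_(n+1)(D)): f takes every matrix of S, viewed over the
   quotient field, to a matrix with entries in D. *)
Definition Int (D : idomainType) (n : nat) (S : 'M[D]_n.+1 -> Prop)
    (f : {poly {fraction D}}) : Prop :=
  forall M : 'M[D]_n.+1, S M ->
    exists N : 'M[D]_n.+1,
      horner_mx (map_mx (@tofrac D) M) f = map_mx (@tofrac D) N.

Definition mx_char_poly (D : idomainType) (n : nat) (p : {poly D})
    (M : 'M[D]_n.+1) : Prop :=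
  char_poly M = p.

(* [companionmx p] has dimension (size p).-1, which is cast here to n.+1. Its
   last row is (- p`_0, .., - p`_n), and the superdiagonal entries are 1. *)
Definition companion (D : idomainType) (n : nat) (p : {poly D})
    (size_p : size p = n.+2) : 'M[D]_n.+1 :=
  castmx (congr1 predn size_p, congr1 predn size_p) (companionmx p).

Definition dvd_poly_mod (D : idomainType) (d : D) (p g : {poly D}) : Prop :=
  exists h k : {poly D}, g = p * h + d *: k.

(* Main.v *)
Require Import Defs.
From mathcomp Require Import all_boot all_order all_algebra.

Set Implicit Arguments.
Unset Strict Implicit.
Unset Printing Implicit Defensive.

Import GRing.Theory.

Local Open Scope ring_scope.

(** Let m be the degree of p. By Cayley-Hamilton, the value of f at a matrix
    whose characteristic polynomial is p only depends on the remainder r of f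
    modulo p ([horner_mx_char_polyD]). So if r has coefficients in D, then f
    maps every such matrix into M_m(D), and in particular the companion matrix
    C_p.

    Conversely the companion matrix reveals r: as C_p shifts the standard basis
    row vectors, e_0 C_p^i = e_i for i < m, and the top row of f(C_p) = r(C_p)
    is the row of coefficients of r ([row0_horner_companion]). So integrality of
    the single matrix f(C_p) already forces r to have coefficients in D
    ([Int_companion_modp]).

    Divisibility of g by p modulo d amounts to the integrality of r because p is
    monic: Euclidean division by p is then possible over D, and by uniqueness it
    agrees with the division over K ([dvd_poly_mod_of_modp],
    [modp_of_dvd_poly_mod]). *)

Lemma horner_mx_char_polyD (R : comNzRingType) (n : nat) (M : 'M[R]_n.+1)
    (r q : {poly R}) :
  horner_mx M (r + char_poly M * q) = horner_mx M r.
Proof. by rewrite rmorphD rmorphM /= Cayley_Hamilton mul0r addr0. Qed.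

(** Each row of C but the last is the next standard basis vector, so
    e_0 C^k = e_k as long as k <= n, and e_0 r(C) lists the coefficients of r.
    Describing C by its entries makes the result apply to any cast or base
    change of [companionmx]. *)
Lemma row0_horner_companion (R : comNzRingType) (n : nat) (C : 'M[R]_n.+1)
    (r : {poly R}) :
    (forall i j : 'I_n.+1, (i < n)%N -> C i j = (i.+1 == j :> nat)%:R) ->
    (size r <= n.+1)%N ->
  row 0 (horner_mx C r) = poly_rV r.
Proof.
move=> superC size_r.
have rowX k : (k < n.+1)%N -> row 0 (C ^+ k) = delta_mx 0 (inord k).
  elim: k => [|k IHk] ltkn.
    by rewrite expr0 row1; congr delta_mx; apply: val_inj; rewrite /= inordK.
  have ltkn' := ltnW ltkn.
  rewrite exprSr row_mul IHk // -rowE; apply/rowP=> j.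
  rewrite !mxE superC ?inordK // eqxx /= -val_eqE /= inordK //.
  by rewrite eq_sym.
rewrite -[r in LHS](poly_rV_K size_r); move: (poly_rV r) => v.
rewrite [in LHS](row_sum_delta v) [in RHS](row_sum_delta v) !raddf_sum /=.
apply: eq_bigr => i _; rewrite linearZ /= rVpoly_delta horner_mxZ linearZ /=.
by rewrite rmorphXn /= horner_mx_X rowX // inord_val.
Qed.

Lemma char_poly_castmx (R : nzRingType) (m k : nat) (e : m = k) (A : 'M[R]_m) :
  char_poly (castmx (e, e) A) = char_poly A.
Proof. by case: k / e; rewrite castmx_id. Qed.

Lemma char_poly_companion (D : idomainType) (n : nat) (p : {poly D})
    (size_p : size p = n.+2) :
  p \is monic -> char_poly (companion size_p) = p.
Proof. by move=> /companionmxK; rewrite char_poly_castmx. Qed.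

Lemma companion_superdiagonal (D : idomainType) (n : nat) (p : {poly D})
    (size_p : size p = n.+2) (i j : 'I_n.+1) :
  (i < n)%N -> companion size_p i j = (i.+1 == j :> nat)%:R.
Proof. by move=> ltin; rewrite castmxE mxE /= size_p /= ltn_eqF. Qed.

Lemma size_map_tofrac (D : idomainType) (p : {poly D}) :
  size (map_poly (@tofrac D) p) = size p.
Proof.
apply: size_map_inj_poly; rewrite ?rmorph0 // => x y /eqP.
by rewrite tofrac_eq => /eqP.
Qed.

Lemma map_tofrac_inj (D : idomainType) : injective (map_poly (@tofrac D)).
Proof.
apply: map_inj_poly; rewrite ?rmorph0 // => x y /eqP.
by rewrite tofrac_eq => /eqP.
Qed.

Lemma size_modp_tofrac (D : idomainType) (p : {poly D})
    (f : {poly {fraction D}}) :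
  p != 0 -> (size (f %% map_poly (@tofrac D) p)%R < size p)%N.
Proof.
by move=> p_neq0; rewrite -(size_map_tofrac p) ltn_modp -size_poly_eq0
  size_map_tofrac size_poly_eq0.
Qed.

Lemma Int_char_poly_of_remainder (D : idomainType) (n : nat) (p r : {poly D})
    (f q : {poly {fraction D}}) :
    f = map_poly (@tofrac D) r + map_poly (@tofrac D) p * q ->
  Int (@mx_char_poly D n p) f.
Proof.
move=> -> M chM; exists (horner_mx M r).
by rewrite -chM map_char_poly horner_mx_char_polyD map_horner_mx.
Qed.

(** The matrix f(C_p) is r(C_p) for r the remainder of f modulo p, and the
    coefficients of r are the entries of its first row. *)
Lemma Int_companion_modp (D : idomainType) (n : nat) (p : {poly D})
    (size_p : size p = n.+2) (f : {poly {fraction D}}) :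
    p \is monic ->
    Int (fun M : 'M[D]_n.+1 => M = companion size_p) f ->
  exists r : {poly D}, f %% map_poly (@tofrac D) p = map_poly (@tofrac D) r.
Proof.
move=> p_monic /(_ _ erefl) [N fC].
exists (rVpoly (row 0 N)).
have size_r : (size (f %% map_poly (@tofrac D) p)%R <= n.+1)%N.
  by rewrite -ltnS -size_p size_modp_tofrac // monic_neq0.
rewrite map_rVpoly map_row -fC -[LHS](poly_rV_K size_r); congr rVpoly.
rewrite [f in RHS](divp_eq f (map_poly (@tofrac D) p)) addrC mulrC.
rewrite -[p in map_poly _ p * _](char_poly_companion size_p p_monic).
rewrite map_char_poly horner_mx_char_polyD row0_horner_companion //.
by move=> i j ltin; rewrite mxE companion_superdiagonal // rmorph_nat.
Qed.

(** As p is monic, dividing g by p over D also divides it by p over K; by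
    uniqueness, the remainder of g over D is d times that of g / d. *)
Lemma dvd_poly_mod_of_modp (D : idomainType) (d : D) (p g r : {poly D}) :
    p \is monic -> d != 0 ->
    ((tofrac d)^-1 *: map_poly (@tofrac D) g) %% map_poly (@tofrac D) p
      = map_poly (@tofrac D) r ->
  dvd_poly_mod d p g.
Proof.
move=> p_monic d_neq0 modf.
exists (Pdiv.Ring.rdivp g p), r.
have g_eq := Pdiv.RingMonic.rdivp_eq p_monic g.
rewrite [LHS]g_eq mulrC; congr (_ + _); apply: map_tofrac_inj.
have dF_neq0 : tofrac d != 0 by rewrite tofrac_eq0.
rewrite map_polyZ /= -modf modpZl scalerA mulfV // scale1r.
apply: (modpP (q := map_poly (@tofrac D) (Pdiv.Ring.rdivp g p))).
  by rewrite -rmorphM -rmorphD -g_eq.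
by rewrite !size_map_tofrac Pdiv.Ring.ltn_rmodpN0 // monic_neq0.
Qed.

(** Dividing k by p in g = p h + d k puts all the non-integrality of g / d into
    the multiple of p. *)
Lemma modp_of_dvd_poly_mod (D : idomainType) (d : D) (p g : {poly D}) :
    p \is monic -> d != 0 -> dvd_poly_mod d p g ->
  exists r : {poly D},
    ((tofrac d)^-1 *: map_poly (@tofrac D) g) %% map_poly (@tofrac D) p
      = map_poly (@tofrac D) r.
Proof.
move=> p_monic d_neq0 [h [k ->]]; exists (Pdiv.Ring.rmodp k p).
have dF_neq0 : tofrac d != 0 by rewrite tofrac_eq0.
rewrite rmorphD rmorphM /= map_polyZ scalerDr scalerA mulVf // scale1r.
rewrite modpD modpZl modp_mulr scaler0 add0r; apply/esym.
apply: (modpP (q := map_poly (@tofrac D) (Pdiv.Ring.rdivp k p))).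
  by rewrite -rmorphM -rmorphD -(Pdiv.RingMonic.rdivp_eq p_monic).
by rewrite !size_map_tofrac Pdiv.Ring.ltn_rmodpN0 // monic_neq0.
Qed.

Theorem lemma2p2 (D : idomainType) (n : nat) (p : {poly D})
    (p_monic : p \is monic) (size_p : size p = n.+2)
    (f : {poly {fraction D}}) (g : {poly D}) (d : D) (d_neq0 : d != 0)
    (f_def : f = (tofrac d)^-1 *: map_poly (@tofrac D) g) :
  [<-> Int (@mx_char_poly D n p) f;
       dvd_poly_mod d p g;
       exists r : {poly D}, f %% map_poly (@tofrac D) p = map_poly (@tofrac D) r;
       exists (q : {poly {fraction D}}) (r : {poly D}),
         (size r < size p)%N /\
         f = map_poly (@tofrac D) r + map_poly (@tofrac D) p * q;
       Int (fun M : 'M[D]_n.+1 => M = companion size_p) f].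
Proof.
have Int_companion : Int (@mx_char_poly D n p) f ->
    Int (fun M : 'M[D]_n.+1 => M = companion size_p) f.
  by move=> IntP M ->; apply/IntP/char_poly_companion.
have remainder (r : {poly D}) :
    f %% map_poly (@tofrac D) p = map_poly (@tofrac D) r ->
    f = map_poly (@tofrac D) r
        + map_poly (@tofrac D) p * (f %/ map_poly (@tofrac D) p).
  by move=> <-; rewrite addrC mulrC -divp_eq.
tfae.
- move=> /Int_companion/(Int_companion_modp p_monic)[r]; rewrite f_def.
  exact: dvd_poly_mod_of_modp.
- by rewrite f_def; apply: modp_of_dvd_poly_mod.
- move=> [r modf]; exists (f %/ map_poly (@tofrac D) p), r.
  split; last exact: remainder.
  by rewrite -(size_map_tofrac r) -modf size_modp_tofrac // monic_neq0.
- move=> [q [r [_ f_eq]]].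
  exact/Int_companion/(Int_char_poly_of_remainder f_eq).
- move=> /(Int_companion_modp p_monic)[r /remainder].
  exact: Int_char_poly_of_remainder.
Qed.
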